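(* Let $(E,f)$ be a polymatroid with $f(E)>0$. Then the function $g:2^E\to\mathbb{R}_{\ge0}$, $g(A)=2f(E)f(A)-f(A)^2$, is a polymatroid, and the monotone path polytope $\mathrm{MPP}_{\mathbf{1}}(P_f)$ of $P_f$ with respect to $\mathbf{1}(x)=\sum_{e\in E}x_e$ equals the base polytope $B_g$.
   Context: A polymatroid is a finite set $E$ with $f:2^E\to\mathbb{R}_{\ge0}$ such that $f(\emptyset)=0$ and $f(A)\le f(A\cup B)\le f(A)+f(B)-f(A\cap B)$ for all $A,B\subseteq E$. Its polymatroid polytope is $P_f=\{x\in\mathbb{R}^E: x\ge0,\ \sum_{e\in A}x_e\le f(A)\ \forall A\subseteq E\}$ and its base polytope is $B_f=\{x\in P_f:\sum_{e\in E}x_e=f(E)\}$. For a polytope $P$ and a linear function $c$ not constant on $P$, with $I=\{\langle c,x\rangle:x\in P\}$, a section is a continuous $\gamma:I\to P$ with $\langle c,\gamma(s)\rangle=s$, and $\mathrm{MPP}_c(P)=\{2\int_I\gamma(s)\,ds:\gamma\text{ a section}\}$. *)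

(* Defs.v *)
From HB Require Import structures.
From mathcomp Require Import all_boot all_order all_algebra.
From mathcomp Require Import all_classical all_reals all_analysis.

Set Implicit Arguments.
Unset Strict Implicit.
Unset Printing Implicit Defensive.

Import Order.TTheory GRing.Theory Num.Theory.
Import numFieldNormedType.Exports.

Local Open Scope classical_set_scope.
Local Open Scope ring_scope.

(* The ground set is a finType E, subsets of E are elements of {set E} (so      *)
(* finset.set0 and [set: E]%SET are the empty and the full subset), and R^E is  *)
(* E -> R; sets of points of R^E are classical sets.                            *)

Record is_polymatroid (R : realType) (E : finType) (f : {set E} -> R) : Prop :=
  IsPolymatroid {
    polymatroid_ge0 : forall A, 0 <= f A;
    polymatroid_set0 : f finset.set0 = 0;
    polymatroid_mono : forall A B, f A <= f (A :|: B)%SET;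
    polymatroid_submod : forall A B,
      f (A :|: B)%SET <= f A + f B - f (A :&: B)%SET }.

Definition polymatroid_polytope (R : realType) (E : finType)
    (f : {set E} -> R) : set (E -> R) :=
  [set x | (forall e, 0 <= x e) /\
           (forall A : {set E}, \sum_(e in A) x e <= f A)].

Definition base_polytope (R : realType) (E : finType)
    (f : {set E} -> R) : set (E -> R) :=
  [set x | polymatroid_polytope f x /\ \sum_e x e = f [set: E]%SET].

(* A linear function on R^E is given by its coefficient vector c : E -> R. *)
Definition pairing (R : realType) (E : finType) (c x : E -> R) : R :=
  \sum_e c e * x e.

(* A section I -> P is a total function R -> R^E of which only the restriction  *)
(* to I = pairing c @` P matters; {ptws E -> R} is R^E with its product         *)
(* topology.                                                                    *)
Definition is_section (R : realType) (E : finType) (c : E -> R)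
    (P : set (E -> R)) (gamma : R -> {ptws E -> R}) : Prop :=
  [/\ {within pairing c @` P, continuous gamma},
      forall s, (pairing c @` P) s -> P (gamma s) &
      forall s, (pairing c @` P) s -> pairing c (gamma s) = s].

(* The integral of the vector-valued gamma is taken coordinatewise. *)
Definition MPP (R : realType) (E : finType) (c : E -> R)
    (P : set (E -> R)) : set (E -> R) :=
  [set x | exists2 gamma : R -> {ptws E -> R}, is_section c P gamma &
     x = fun e =>
       2 * \int[@lebesgue_measure R]_(s in pairing c @` P) gamma s e].

(* Main.v *)
(**
Write [F = f(E)]. If [gamma] is a section, then [gamma(s)(A) <= min(s, f(A))]
for all [s] in [[0, F]], with equality for [A = E], and
[2 * int_0^F min(s, f(A)) ds = g(A)]; so [2 * int gamma] lies in [B_g].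

Conversely, [MPP] is convex, so it suffices to reach the vertices of [B_g],
which are the greedy vectors [e_k |-> g(A_k) - g(A_(k-1))] of complete flags
[A_0 < ... < A_n = E]. The truncation [min(s, f)] is again a polymatroid, and
its greedy vectors along the flag, as [s] runs over [[0, F]], form a section
whose doubled integral is the greedy vector of [g]. That every base is a convex
combination of greedy vectors is shown by induction on the number of non-tight
sets: either the tight sets contain a complete flag, or two elements [i], [j]
are separated by no tight set, and moving weight from [i] to [j] and from [j]
to [i] as far as possible writes the base as a convex combination of two bases
with more tight sets.
*)
Require Import Defs.
From HB Require Import structures.
From mathcomp Require Import all_boot all_order all_algebra.
From mathcomp Require Import all_classical all_reals all_analysis.
From mathcomp Require Import ring lra.

Set Implicit Arguments.
Unset Strict Implicit.
Unset Printing Implicit Defensive.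

Import Order.TTheory GRing.Theory Num.Theory.
Import numFieldNormedType.Exports.

Local Open Scope classical_set_scope.
Local Open Scope ring_scope.

(** * Sums over subsets of the ground set *)

Section SetSums.
Context {R : realType} {E : finType}.
Implicit Types (x : E -> R) (A B : {set E}).

Lemma sum_setT x : \sum_(e in [set: E]%SET) x e = \sum_e x e.
Proof. by apply: eq_bigl => e; rewrite !inE. Qed.

Lemma sum_setUI x A B :
  \sum_(e in (A :|: B)%SET) x e + \sum_(e in (A :&: B)%SET) x e =
  \sum_(e in A) x e + \sum_(e in B) x e.
Proof.
have [UA UD] : ((A :|: B) :&: A = A /\ (A :|: B) :\: A = B :\: A)%SET.
  by split; apply/setP => e; rewrite !inE; case: (e \in A); case: (e \in B).
rewrite (big_setID A) UA UD (finset.setIC A) -addrA; congr (_ + _).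
by rewrite [RHS](big_setID A) addrC.
Qed.

Lemma sum_transfer x (i j : E) (t : R) A :
  \sum_(e in A) (x e + t * ((e == i)%:R - (e == j)%:R)) =
  \sum_(e in A) x e + t * ((i \in A)%:R - (j \in A)%:R).
Proof.
have delta k : \sum_(e in A) (e == k)%:R = (k \in A)%:R :> R.
  have [kA|kA] := boolP (k \in A).
    rewrite (big_setD1 k) //= eqxx big1 ?addr0 // => e.
    by rewrite !inE => /andP[/negbTE ->].
  by rewrite big1 // => e eA; case: eqP => // ek; rewrite -ek eA in kA.
by rewrite big_split -mulr_sumr sumrB !delta.
Qed.

End SetSums.

(** * Polymatroids obtained from concave functions *)

Section Polymatroid.
Context {R : realType} {E : finType}.
Variable h : {set E} -> R.
Hypothesis hP : is_polymatroid h.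
Implicit Types (x : E -> R) (A B : {set E}).

Lemma polymatroid_subset A B : A \subset B -> h A <= h B.
Proof. by move=> /finset.setUidPr <-; exact: polymatroid_mono hP _ _. Qed.

Lemma polymatroid_le_full A : h A <= h [set: E]%SET.
Proof. exact/polymatroid_subset/finset.subsetT. Qed.

(** Truncating at [s] is concave and nondecreasing, and such functions preserve monotonicity and
    submodularity. Comparing [s] with the four values involved leaves linear inequalities. *)
Lemma polymatroid_truncation (s : R) :
  0 <= s -> is_polymatroid (fun A => Num.min s (h A)).
Proof.
move=> s0; split => [A||A B|A B].
- by rewrite le_min s0 (polymatroid_ge0 hP).
- by rewrite (polymatroid_set0 hP); exact/min_idPr.
- by rewrite le_min2 // (polymatroid_mono hP).
have := polymatroid_submod hP A B; have := polymatroid_mono hP A B.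
have : h B <= h (A :|: B)%SET by rewrite polymatroid_subset // finset.subsetUr.
have : h (A :&: B)%SET <= h A by rewrite polymatroid_subset // finset.subsetIl.
have : h (A :&: B)%SET <= h B by rewrite polymatroid_subset // finset.subsetIr.
case: (leP s (h A)); case: (leP s (h B)); case: (leP s (h (A :|: B)%SET));
  case: (leP s (h (A :&: B)%SET)); lra.
Qed.

(** The map [t |-> 2 F t - t^2] is concave and nondecreasing on [[0, F]], where [h] takes its
    values. *)
Lemma polymatroid_quadratic :
  is_polymatroid (fun A => 2 * h [set: E]%SET * h A - h A ^+ 2).
Proof.
have h0 A := polymatroid_ge0 hP A; have hF A := polymatroid_le_full A.
split => [A||A B|A B].
- by have := h0 A; have := hF A; nra.
- by rewrite (polymatroid_set0 hP); ring.
- have := polymatroid_mono hP A B; have := hF (A :|: B)%SET; have := hF A.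
  nra.
have := polymatroid_submod hP A B.
have := polymatroid_mono hP A B; have := hF (A :|: B)%SET.
have : h B <= h (A :|: B)%SET by rewrite polymatroid_subset // finset.subsetUr.
have : h (A :&: B)%SET <= h A by rewrite polymatroid_subset // finset.subsetIl.
have : h (A :&: B)%SET <= h B by rewrite polymatroid_subset // finset.subsetIr.
move: (h _) (h A) (h B) (h (A :|: B)%SET) (h (A :&: B)%SET) => F a b d c.
move=> cb ca bd dF ad sub.
(* These are the increments of [2 F t - t^2] from [b] to [d] and from [c] to [a], factored so that
   they compare factor by factor. *)
have : (d - b) * (2 * F - d - b) <= (a - c) * (2 * F - a - c).
  apply: ler_pM; lra.
nra.
Qed.

(** Nonnegativity is automatic: the complement of [e] carries at most [h(E - e) <= h(E)], which is
    the total weight. *)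
Lemma base_polytopeP x :
  (forall A, \sum_(e in A) x e <= h A) -> \sum_e x e = h [set: E]%SET ->
  base_polytope h x.
Proof.
move=> xle xE; split => //; split => // e.
have sumD : \sum_i x i = x e + \sum_(i in [set~ e]%SET) x i.
  by rewrite (bigD1 e) //=; congr (_ + _); apply: eq_bigl => i; rewrite !inE.
have := xle [set~ e]%SET; have := polymatroid_le_full [set~ e]%SET.
by rewrite -xE sumD; lra.
Qed.

End Polymatroid.

(** * Flags of initial sets *)

Section InitialSets.
Context {E : finType}.
Variable r : E -> nat.
Hypothesis r_inj : injective r.

(** A complete flag is encoded by an injective rank [r]. Ranks may have gaps, so consecutive initial
    sets may coincide. *)
Definition initial (k : nat) : {set E} := [set e | (r e < k)%N]%SET.

Lemma initialS k : initial k.+1 = initial k \/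
  exists2 e, r e = k & initial k.+1 = (e |: initial k)%SET.
Proof.
case: (pickP (fun e => r e == k)) => [e /eqP rek|nek]; [right; exists e|left] => //.
  apply/setP => i; rewrite !inE ltnS leq_eqVlt -rek; congr (_ || _).
  by apply/eqP/eqP => [/r_inj|->].
by apply/setP => i; rewrite !inE ltnS leq_eqVlt nek.
Qed.

Lemma initial_full : exists k, initial k = [set: E]%SET.
Proof.
exists (\max_e r e).+1; apply/setP => e; rewrite !inE ltnS.
exact: leq_bigmax.
Qed.

End InitialSets.

(** * Greedy vectors are bases *)

Section GreedyVector.
Context {R : realType} {E : finType}.
Implicit Types (h : {set E} -> R) (r : E -> nat) (x : E -> R).

Definition greedy h r (e : E) : R := h (initial r (r e).+1) - h (initial r (r e)).

Lemma eq_greedy h r x : injective r ->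
  (forall k, \sum_(e in initial r k) x e = h (initial r k)) -> x =1 greedy h r.
Proof.
move=> r_inj xh e; rewrite /greedy -!xh.
have -> : initial r (r e).+1 = (e |: initial r (r e))%SET.
  have [+|[i /r_inj -> //]] := initialS r_inj (r e).
  by move=> /setP/(_ e); rewrite !inE ltnS leqnn ltnn.
by rewrite big_setU1 ?inE ?ltnn //= addrK.
Qed.

Lemma sum_greedy_initial h r k : injective r -> h finset.set0 = 0 ->
  \sum_(e in initial r k) greedy h r e = h (initial r k).
Proof.
move=> r_inj h0; elim: k => [|k IH].
  have -> : initial r 0 = finset.set0 by apply/setP => e; rewrite !inE.
  by rewrite big_set0.
have [->//|[e rek ekE]] := initialS r_inj k.
by rewrite {1}ekE big_setU1 ?inE ?rek ?ltnn //= IH /greedy rek subrK.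
Qed.

(** Induction along the flag: by submodularity, adding [e] to [A :&: initial r k] raises [h] at
    least as much as adding it to [initial r k], which is the greedy coordinate of [e]. *)
Lemma sum_greedy_le h r (A : {set E}) : is_polymatroid h -> injective r ->
  \sum_(e in A) greedy h r e <= h A.
Proof.
move=> hP r_inj.
suff H k : \sum_(e in (A :&: initial r k)%SET) greedy h r e <=
           h (A :&: initial r k)%SET.
  by have [k kE] := initial_full r; have := H k; rewrite kE finset.setIT.
elim: k => [|k IH].
  have -> : initial r 0 = finset.set0 by apply/setP => e; rewrite !inE.
  by rewrite finset.setI0 big_set0 (polymatroid_set0 hP).
have [->//|[e rek ekE]] := initialS r_inj k.
have [eA|eA] := boolP (e \in A); last first.
  suff -> : (A :&: initial r k.+1 = A :&: initial r k)%SET by [].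
  apply/setP => i; rewrite ekE !inE; have [->|//] := eqVneq i e.
  by rewrite (negbTE eA).
have e_notin : e \notin initial r k by rewrite inE rek ltnn.
have AE : (A :&: initial r k.+1 = e |: (A :&: initial r k))%SET.
  by rewrite ekE finset.setIUr (finset.setIidPr _) // finset.sub1set.
have e_notinA : e \notin (A :&: initial r k)%SET.
  by rewrite finset.in_setI (negbTE e_notin) andbF.
rewrite AE big_setU1 //=.
have := polymatroid_submod hP (e |: (A :&: initial r k))%SET (initial r k).
have -> : (e |: (A :&: initial r k) :|: initial r k = initial r k.+1)%SET.
  by rewrite ekE -finset.setUA (finset.setUidPr (finset.subsetIr _ _)).
have -> : ((e |: (A :&: initial r k)) :&: initial r k = A :&: initial r k)%SET.
  apply/setP => i; rewrite !finset.in_setI finset.in_setU1 finset.in_setI.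
  have [->|_] := eqVneq i e; first by rewrite (negbTE e_notin) !andbF.
  by rewrite /= -andbA andbb.
rewrite [greedy h r e]/greedy rek; move: IH; lra.
Qed.

Lemma greedy_base h r : is_polymatroid h -> injective r ->
  base_polytope h (greedy h r).
Proof.
move=> hP r_inj; apply: base_polytopeP => // [A|]; first exact: sum_greedy_le.
have [k kE] := initial_full r.
by rewrite -sum_setT -kE sum_greedy_initial // (polymatroid_set0 hP).
Qed.

End GreedyVector.

(** * Tight sets and the decomposition of bases *)

Section Tight.
Context {R : realType} {E : finType}.
Variable h : {set E} -> R.
Hypothesis hP : is_polymatroid h.
Implicit Types (x : E -> R) (A B C T : {set E}).

Definition tight x A : bool := \sum_(e in A) x e == h A.

Lemma tight_set0 x : tight x finset.set0.
Proof. by rewrite /tight big_set0 (polymatroid_set0 hP). Qed.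

(** Uncrossing: [x(A U B) + x(A n B) = h(A) + h(B) >= h(A U B) + h(A n B)], so both upper bounds are
    attained. *)
Lemma tightUI x A B : (forall C, \sum_(e in C) x e <= h C) ->
  tight x A -> tight x B -> tight x (A :|: B)%SET /\ tight x (A :&: B)%SET.
Proof.
move=> xle /eqP xA /eqP xB; have := sum_setUI x A B.
have := xle (A :|: B)%SET; have := xle (A :&: B)%SET.
have := polymatroid_submod hP A B.
by move=> *; split; apply/eqP; lra.
Qed.

(* A maximal chain of tight sets must be a full flag: a tight set separating
   two elements of a gap would refine the chain. *)
Lemma tight_flag x A : (forall C, \sum_(e in C) x e <= h C) ->
  (forall i j, i != j -> exists2 T, tight x T & (i \in T) != (j \in T)) ->
  tight x A ->
  exists r : E -> nat, [/\ {in A &, injective r},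
    forall e, e \in A -> (r e < #|A|)%N &
    forall k, tight x [set e in A | (r e < k)%N]%SET].
Proof.
move=> xle sep; have [n] := ubnP #|A|; elim: n A => // n IH A An tA.
have [->|A0] := eqVneq A finset.set0.
  exists (fun=> 0%N); split => [i j|i|k]; rewrite ?inE //.
  suff -> : [set e in finset.set0 | (0 < k)%N]%SET = finset.set0 :> {set E}.
    exact: tight_set0.
  by apply/setP => e; rewrite !inE.
pose tight_proper T := tight x T && (T \proper A).
have T0P : tight_proper finset.set0.
  by rewrite /tight_proper tight_set0 finset.proper0.
case: (arg_maxnP (fun T => #|T|) T0P) => T /andP[tT TA] Tmax.
have [TsubA [e eA eT]] := properP TA.
(* For a second [j] in [A] outside [T], a tight [U] separating [e] from [j] makes [(T U U) n A]
   tight, proper in [A] and strictly larger than [T]. *)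
have AE : A = (e |: T)%SET.
  apply/eqP; rewrite finset.eqEsubset finset.subUset finset.sub1set eA TsubA !andbT.
  apply/fintype.subsetP => j jA; rewrite !inE; apply/norP => -[je jT].
  have [U tU sepU] := sep _ _ je.
  have [tTU _] := tightUI xle tT tU.
  have [_ tW] := tightUI xle tTU tA.
  set W := ((T :|: U) :&: A)%SET in tW.
  have eW : (e \in W) = (e \in U) by rewrite !inE eA (negbTE eT) andbT.
  have jW : (j \in W) = (j \in U) by rewrite !inE jA (negbTE jT) andbT.
  have WA : W \proper A.
    rewrite finset.properEneq finset.subsetIr andbT; apply: contra sepU => /eqP WE.
    by rewrite -eW -jW WE eA jA.
  have TW : T = W.
    apply/eqP; rewrite finset.eqEcard finset.subsetI TsubA finset.subsetUl.
    by apply: Tmax; rewrite /tight_proper tW.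
  by move: sepU; rewrite -eW -jW -TW (negbTE eT) (negbTE jT) eqxx.
have cA : #|A| = #|T|.+1 by rewrite AE finset.cardsU1 eT.
have [r [r_inj r_lt r_tight]] : exists r : E -> nat, [/\ {in T &, injective r},
    forall e, e \in T -> (r e < #|T|)%N &
    forall k, tight x [set e in T | (r e < k)%N]%SET].
  by apply: IH => //; rewrite -ltnS -cA.
exists (fun i => if i == e then #|T| else r i); split.
- move=> i j; rewrite AE !inE.
  have [->|ie] := eqVneq i e; have [->|je] := eqVneq j e => //= iT jT.
  + by move=> rj; have := r_lt _ jT; rewrite -rj ltnn.
  + by move=> ri; have := r_lt _ iT; rewrite ri ltnn.
  + exact: r_inj.
- move=> i; rewrite cA AE !inE; case: eqVneq => //= _ /r_lt ri.
  exact: ltnW.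
- move=> k; have [kT|Tk] := leqP k #|T|.
    suff -> : [set i in A | ((if i == e then #|T| else r i) < k)%N]%SET =
              [set i in T | (r i < k)%N]%SET by [].
    apply/setP => i; rewrite AE !inE; have [->|//] := eqVneq i e.
    by rewrite (negbTE eT) ltnNge kT.
  suff -> : [set i in A | ((if i == e then #|T| else r i) < k)%N]%SET = A by [].
  apply/setP => i; rewrite AE !inE; case: eqVneq => //= _.
  by have [/r_lt/ltn_trans->|] := boolP (i \in T).
Qed.

Lemma separated_greedy x : base_polytope h x ->
  (forall i j, i != j -> exists2 T, tight x T & (i \in T) != (j \in T)) ->
  exists2 r : E -> nat, injective r & x =1 greedy h r.
Proof.
move=> [[_ xle] xE] sep.
have [|r [r_inj _ r_tight]] := @tight_flag x [set: E]%SET xle sep.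
  by apply/eqP; rewrite sum_setT.
have r_inj' : injective r by move=> i j; apply: r_inj; rewrite !inE.
exists r => //; apply: eq_greedy => // k; have /eqP := r_tight k.
suff -> : [set e in [set: E] | (r e < k)%N]%SET = initial r k by [].
by apply/setP => e; rewrite !inE.
Qed.

(** Moving weight from [j] to [i] increases only the sums over sets containing [i] but not [j];
    tight sets contain both or neither, so they stay tight. *)
Lemma base_transfer x i j : base_polytope h x -> i != j ->
  (forall T, tight x T -> (i \in T) = (j \in T)) ->
  exists2 t : R, 0 < t &
    let y e := x e + t * ((e == i)%:R - (e == j)%:R) in
    base_polytope h y /\
    (#|[set A | ~~ tight y A]%SET| < #|[set A | ~~ tight x A]%SET|)%N.
Proof.
move=> [[x0 xle] xE] ij insep.
pose separates A := (i \in A) && (j \notin A).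
have iP : separates [set i]%SET by rewrite /separates !inE eqxx eq_sym.
pose slack A := h A - \sum_(e in A) x e.
(* The least slack among the sets that gain weight is the largest admissible transfer, and it makes
   [B] tight. *)
case: (@Order.TotalTheory.arg_minP _ _ _ _ _ slack iP) => B /andP[iB jB] Bmin.
have tB : ~~ tight x B by apply/negP => /insep; rewrite iB (negbTE jB).
have t0 : 0 < slack B by rewrite subr_gt0 lt_neqAle tB xle.
exists (slack B) => //= ; set y := fun e => _.
have yA A : \sum_(e in A) y e =
    \sum_(e in A) x e + slack B * ((i \in A)%:R - (j \in A)%:R).
  exact: sum_transfer.
split.
  apply: base_polytopeP => // [A|].
    rewrite yA; have := xle A.
    have [iA|iA] := boolP (i \in A); have [jA|jA] := boolP (j \in A) => /=.
    - by rewrite subrr mulr0 addr0.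
    - by have := Bmin A; rewrite /separates iA jA => /(_ isT); rewrite /slack subr0; lra.
    - by move: t0; lra.
    - by rewrite subrr mulr0 addr0.
  by rewrite -sum_setT yA sum_setT xE !inE subrr mulr0 addr0.
apply/proper_card/properP; split.
  apply/fintype.subsetP => A; rewrite !inE; apply: contra => tA.
  by rewrite /tight yA (insep _ tA) subrr mulr0 addr0.
exists B; rewrite !inE // negbK /tight yA iB (negbTE jB) subr0 mulr1 /slack.
by rewrite addrC subrK.
Qed.

(** Expresses that bases are convex combinations of greedy vectors, as an induction principle for
    convex predicates. *)
Lemma base_polytope_ind (P : (E -> R) -> Prop) :
  (forall r, injective r -> P (greedy h r)) ->
  (forall x y t, 0 <= t <= 1 -> P x -> P y ->
    P (fun e => t * x e + (1 - t) * y e)) ->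
  forall x, base_polytope h x -> P x.
Proof.
move=> Pgreedy Pconv x; have [n] := ubnP #|[set A | ~~ tight x A]%SET|.
elim: n x => // n IH x xn xB.
have [sep|] := pselect (forall i j, i != j ->
    exists2 T, tight x T & (i \in T) != (j \in T)).
  have [r r_inj xr] := separated_greedy xB sep.
  by rewrite (funext xr); exact: Pgreedy.
move=> /existsNP[i /existsNP[j /not_implyP[ij nosep]]].
have insep T : tight x T -> (i \in T) = (j \in T).
  by move=> tT; apply/eqP; apply: contra_notT nosep => ijT; exists T.
have insep' T : tight x T -> (j \in T) = (i \in T) by move=> /insep.
have [t t0 [yB yn]] := base_transfer xB ij insep.
have ji : j != i by rewrite eq_sym.
have [u u0 [zB zn]] := base_transfer xB ji insep'.
have Py := IH _ (leq_trans yn xn) yB; have Pz := IH _ (leq_trans zn xn) zB.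
have tu0 : 0 < u + t by rewrite addr_gt0.
(* The bases are [x + t (e_i - e_j)] and [x - u (e_i - e_j)]; weights [u / (u + t)] and
   [t / (u + t)] cancel the shifts. *)
have u01 : 0 <= u / (u + t) <= 1.
  by rewrite ler_pdivrMr // mul1r lerDl (ltW t0) andbT divr_ge0 // ltW.
have := Pconv _ _ _ u01 Py Pz; congr P; apply/funext => e.
by field; rewrite gt_eqF.
Qed.

End Tight.

(** * Integrals of continuous functions on segments *)

Section Integrals.
Context {R : realType}.
Let mu := @lebesgue_measure R.

Lemma within_continuous_integrable (a b : R) (u : R -> R) :
  {within `[a, b], continuous u} -> mu.-integrable `[a, b] (EFin \o u).
Proof.
by move=> cu; apply: continuous_compact_integrable => //; exact: segment_compact.
Qed.

Lemma Rintegral_sum (I : finType) (P : pred I) (a b : R) (u : I -> R -> R) :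
  (forall i, {within `[a, b], continuous (u i)}) ->
  \int[mu]_(s in `[a, b]) (\sum_(i | P i) u i s) =
  \sum_(i | P i) \int[mu]_(s in `[a, b]) u i s.
Proof.
move=> cu; rewrite /Rintegral.
under eq_integral do rewrite -sumEFin.
rewrite integral_sum //=; last first.
  by move=> i; exact: within_continuous_integrable.
rewrite sum_fine // => i _; apply: integrable_fin_num => //.
exact: within_continuous_integrable.
Qed.

Lemma Rintegral_id (a : R) : 0 <= a -> \int[mu]_(s in `[0, a]) s = a ^+ 2 / 2.
Proof.
rewrite le_eqVlt => /predU1P[<-|a0].
  by rewrite set_itv1 Rintegral_set1 expr0n mul0r.
rewrite /Rintegral (@continuous_FTC2 _ idfun (fun s => s ^+ 2 / 2)) //=.
- by rewrite expr0n /= mul0r subr0.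
- by apply: continuous_subspaceT => s; exact: cvg_id.
- split=> [s _||].
  + exact: derivableM.
  + apply: cvg_at_right_filter.
    by apply: cvgM; [exact: exprn_continuous|exact: cvg_cst].
  + apply: cvg_at_left_filter.
    by apply: cvgM; [exact: exprn_continuous|exact: cvg_cst].
- move=> s _; rewrite derive1E deriveM //.
  rewrite exp_derive derive_cst scaler0 add0r /= expr1 /GRing.scale /=.
  by field.
Qed.

Lemma continuous_minr_cst (a : R) : continuous (fun s : R => Num.min s a).
Proof.
move=> s; under eq_fun do rewrite minr_absE.
apply: cvgM; last exact: cvg_cst.
apply: cvgB; first by apply: cvgD; [exact: cvg_id|exact: cvg_cst].
by apply: cvg_norm; apply: cvgB; [exact: cvg_id|exact: cvg_cst].
Qed.

(** Splitting at [a], where the integrand becomes constant, gives [a^2 / 2 + a (b - a)]. *)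
Lemma Rintegral_min (a b : R) : 0 <= a <= b ->
  \int[mu]_(s in `[0, b]) Num.min s a = b * a - a ^+ 2 / 2.
Proof.
move=> /andP[a0 ab].
have imin c d : mu.-integrable `[c, d] (EFin \o (fun s => Num.min s a)).
  apply: within_continuous_integrable; apply: continuous_subspaceT.
  exact: continuous_minr_cst.
have /eqP := @Rintegral_itvB _ (fun s => Num.min s a) (BLeft 0) (BRight b) a
  (imin _ _) a0 ab.
rewrite Rintegral_itv_obnd_cbnd; last first.
  by apply: integrableS (imin a b) => //; exact: subset_itv_oc_cc.
rewrite subr_eq => /eqP ->.
rewrite (@eq_Rintegral _ _ _ mu `[a, b] (cst a)); last first.
  by move=> s; rewrite inE /= in_itv /= => /andP[sa _]; exact/min_idPr.
rewrite (@eq_Rintegral _ _ _ mu `[0, a] id); last first.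
  by move=> s; rewrite inE /= in_itv /= => /andP[_ sa]; exact/min_idPl.
rewrite Rintegral_id // Rintegral_cst //= lebesgue_measure_itv /= lte_fin.
move: ab; rewrite le_eqVlt => /predU1P[<-|ab].
  by rewrite ltxx /=; field.
by rewrite ab /=; field.
Qed.

End Integrals.

(** Reduces sections to their coordinates; [T] is arbitrary so that it can be an interval with its
    subspace topology. *)
Lemma continuous_ptwsP {R : realType} {E : finType} {T : topologicalType}
    (u : T -> {ptws E -> R}) :
  continuous u <-> forall e, continuous (fun s => u s e).
Proof.
split=> [cu e s|cu s].
  have ce : continuous (fun v : {ptws E -> R} => v e).
    exact: (@proj_continuous E (fun=> R) e).
  apply: (@continuous_comp _ _ _ u (fun v : {ptws E -> R} => v e)).
    exact: cu.
  exact: ce.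
by apply/cvg_sup => e; exact: continuous_comp_initial (cu e) s.
Qed.

(** * Sections of the polymatroid polytope *)

Section MonotonePaths.
Context {R : realType} {E : finType}.
Variable f : {set E} -> R.
Hypothesis fP : is_polymatroid f.
Let F := f [set: E]%SET.
Let mu := @lebesgue_measure R.
Let one := fun _ : E => 1 : R.
Let g (A : {set E}) := 2 * F * f A - f A ^+ 2.

Lemma pairing_one (x : E -> R) : pairing one x = \sum_e x e.
Proof. by apply: eq_bigr => e _; rewrite mul1r. Qed.

(** A base of [min(s, f)] satisfies the bounds of [f] and has total [min(s, F) = s]. *)
Lemma greedy_truncation (s : R) (r : E -> nat) : 0 <= s <= F -> injective r ->
  polymatroid_polytope f (greedy (fun A => Num.min s (f A)) r) /\
  \sum_e greedy (fun A => Num.min s (f A)) r e = s.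
Proof.
move=> /andP[s0 sF] r_inj.
have [[x0 xle] ->] := greedy_base (polymatroid_truncation fP s0) r_inj.
split; last exact/min_idPl.
split => // A; apply: le_trans (xle A) _.
by rewrite ge_min lexx orbT.
Qed.

Lemma pairing_image : pairing one @` polymatroid_polytope f = `[0, F]%classic.
Proof.
apply/seteqP; split => [_ [x [x0 xle] <-]|s] /=; rewrite in_itv /=.
  by rewrite pairing_one sumr_ge0 //= -sum_setT xle.
(* Any ordering of [E] yields a point of level [s]. *)
move=> sF; have r_inj : injective (fun e : E => val (enum_rank e)).
  by move=> i j /val_inj/enum_rank_inj.
have [xP xs] := greedy_truncation sF r_inj.
by exists (greedy (fun A => Num.min s (f A)) (fun e => val (enum_rank e)));
  rewrite ?pairing_one.
Qed.

Lemma MPP_base x : MPP one (polymatroid_polytope f) x -> base_polytope g x.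
Proof.
move=> [gamma []]; rewrite pairing_image => /continuous_ptwsP cg gP gs ->.
have gs' s : `[0, F]%classic s -> \sum_e gamma s e = s.
  by move=> sF; rewrite -pairing_one gs.
have sumE (A : {set E}) :
    \sum_(e in A) 2 * \int[mu]_(s in `[0, F]) gamma s e =
    2 * \int[mu]_(s in `[0, F]) \sum_(e in A) gamma s e.
  by rewrite -mulr_sumr Rintegral_sum.
have F0 : 0 <= F := polymatroid_ge0 fP _.
apply: base_polytopeP; first exact: polymatroid_quadratic.
  move=> A; rewrite sumE.
  have : \int[mu]_(s in `[0, F]) (\sum_(e in A) gamma s e) <=
         \int[mu]_(s in `[0, F]) Num.min s (f A).
    apply: le_Rintegral => //.
    - apply: within_continuous_integrable.
      by apply: continuous_big => [|e _]; [exact: add_continuous|exact: cg].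
    - apply: within_continuous_integrable; apply: continuous_subspaceT.
      exact: continuous_minr_cst.
    (* The bound by [s] holds because the coordinates outside [A] are nonnegative and all of them
       sum to [s]. *)
    move=> s sF; have [g0 gle] := gP s sF; rewrite le_min gle andbT.
    rewrite -[leRHS](gs' s sF) [leRHS](bigID (mem A)) /=.
    by rewrite lerDl sumr_ge0.
  rewrite Rintegral_min ?(polymatroid_ge0 fP) ?polymatroid_le_full //.
  by rewrite /g; lra.
rewrite -sum_setT sumE (@eq_Rintegral _ _ _ mu _ id) ?Rintegral_id //.
  by rewrite /g -/F; field.
by move=> s /set_mem sF; rewrite sum_setT gs'.
Qed.

(** Pointwise convex combinations of sections are sections, and integration is linear. *)
Lemma MPP_convex x y t : 0 <= t <= 1 ->
  MPP one (polymatroid_polytope f) x -> MPP one (polymatroid_polytope f) y ->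
  MPP one (polymatroid_polytope f) (fun e => t * x e + (1 - t) * y e).
Proof.
move=> /andP[t0 t1] [u [cu uP us] ->] [v [cv vP vs] ->].
have t1' : 0 <= 1 - t by rewrite subr_ge0.
move: cu cv uP vP us vs; rewrite pairing_image.
move=> /continuous_ptwsP cu /continuous_ptwsP cv uP vP us vs.
exists (fun s e => t * u s e + (1 - t) * v s e).
  rewrite /is_section pairing_image; split.
  - apply/continuous_ptwsP => e s; apply: cvgD.
    + by apply: cvgM; [exact: cvg_cst|exact: cu].
    + by apply: cvgM; [exact: cvg_cst|exact: cv].
  - move=> s sF; have [u0 ule] := uP s sF; have [v0 vle] := vP s sF.
    split=> [e|A]; first by rewrite addr_ge0 // mulr_ge0.
    rewrite big_split /= -!mulr_sumr.
    have := ler_wpM2l t0 (ule A); have := ler_wpM2l t1' (vle A); lra.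
  - move=> s sF; have := us s sF; have := vs s sF; rewrite !pairing_one => vE uE.
    by rewrite big_split /= -!mulr_sumr vE uE; ring.
apply/funext => e.
have iu := within_continuous_integrable (cu e).
have iv := within_continuous_integrable (cv e).
rewrite pairing_image RintegralD // ?RintegralZl //; first by ring.
- apply: within_continuous_integrable => s.
  by apply: cvgM; [exact: cvg_cst|exact: cu].
- apply: within_continuous_integrable => s.
  by apply: cvgM; [exact: cvg_cst|exact: cv].
Qed.

Lemma greedy_MPP (r : E -> nat) : injective r ->
  MPP one (polymatroid_polytope f) (greedy g r).
Proof.
move=> r_inj; have cmin a : continuous (fun s : R => Num.min s a).
  exact: continuous_minr_cst.
exists (fun s => greedy (fun A => Num.min s (f A)) r).
  rewrite /is_section pairing_image; split.
  - apply: continuous_subspaceT; apply/continuous_ptwsP => e s.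
    by apply: cvgB; exact: cmin.
  - by move=> s sF; have [] := greedy_truncation sF r_inj.
  - by move=> s sF; rewrite pairing_one; have [] := greedy_truncation sF r_inj.
(* Each coordinate is a difference of two functions [min(s, f(A))], and each integrates to
   [g(A) / 2]. *)
apply/funext => e; rewrite pairing_image RintegralB //; last first.
- by apply: within_continuous_integrable; apply: continuous_subspaceT.
- by apply: within_continuous_integrable; apply: continuous_subspaceT.
rewrite !Rintegral_min ?(polymatroid_ge0 fP) ?polymatroid_le_full //.
by rewrite /greedy /g; field.
Qed.

End MonotonePaths.

Theorem theorem3p8 (R : realType) (E : finType) (f : {set E} -> R) :
  is_polymatroid f -> 0 < f [set: E]%SET ->
  let g : {set E} -> R := fun A => 2 * f [set: E]%SET * f A - f A ^+ 2 in
  is_polymatroid g /\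
  MPP (fun _ : E => 1) (polymatroid_polytope f) = base_polytope g.
Proof.
move=> fP _ g; have gP : is_polymatroid g := polymatroid_quadratic fP.
split => //; apply/seteqP; split => x; first exact: MPP_base.
apply: base_polytope_ind => // [r|y z t]; [exact: greedy_MPP|exact: MPP_convex].
Qed.
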